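(* Fix positive constants $\alpha>1$, $\beta$ and $\gamma$, and let $m=\beta n^{\alpha}$, $p=\gamma n^{-(1+\alpha)/2}$. Then w.h.p. the class of random intersection graphs $G(n,m,p)$ defined by these constants has bounded expansion: there is a function $f$ such that for every $r\ge 0$, $\Pr[\tilde\nabla_r(G(n,m,p))\le f(r)]\to 1$ as $n\to\infty$.
   Context: Random intersection graph $G(n,m,p)$: take a random bipartite graph $B=(V,A,E)$ with $|V|=n$ vertices, $|A|=m$ attributes, each of the $nm$ possible $V$–$A$ edges present independently with probability $p$; $G(n,m,p)$ has vertex set $V$ and two distinct vertices are adjacent iff they have a common neighbour in $B$. ''W.h.p.'' means with probability tending to $1$ as $n\to\infty$. For half-integer $r\ge0$, $H$ is an $r$-shallow topological minor of $G$ if $G$ contains as a subgraph a subdivision of $H$ in which every edge of $H$ is replaced by a path of length at most $2r+1$. The density of a graph is $|E|/|V|$, and $\tilde\nabla_r(G)$ denotes the maximum density of an $r$-shallow topological minor of $G$. *)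

(* Defs.v *)
From Stdlib Require Import Reals ClassicalEpsilon.
From mathcomp Require Import all_boot.

Set Implicit Arguments.
Unset Strict Implicit.
Unset Printing Implicit Defensive.

Definition bipartite (n m : nat) := {set 'I_n * 'I_m}.

Definition igraph (n m : nat) (E : bipartite n m) : rel 'I_n :=
  fun i j => (i != j) && [exists a : 'I_m, ((i, a) \in E) && ((j, a) \in E)].

Definition bip_weight (n m : nat) (p : R) (E : bipartite n m) : R :=
  Rmult (pow p #|E|) (pow (Rminus R1 p) (n * m - #|E|)).

Definition prob (n m : nat) (p : R) (P : bipartite n m -> Prop) : R :=
  \big[Rplus/R0]_(E : bipartite n m)
     (if excluded_middle_informative (P E) then bip_weight p E else R0).

Definition num_edges (k : nat) (h : rel 'I_k) : nat :=
  #|[set uv : 'I_k * 'I_k | h uv.1 uv.2 && (uv.1 < uv.2)]|.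

(* H (a simple graph on 'I_k) is an r-shallow topological minor of G, where
   t = 2r (r a half-integer >= 0): G contains as a subgraph a subdivision of H
   in which each edge of H is replaced by a path of length at most t + 1 = 2r+1.
   phi maps branch vertices injectively; P u v lists the internal vertices of
   the path replacing the edge uv (for u < v). *)
Definition shallow_top_minor (T : finType) (g : rel T) (t : nat)
  (k : nat) (h : rel 'I_k) : Prop :=
  exists (phi : 'I_k -> T) (P : 'I_k -> 'I_k -> seq T),
    injective phi /\
    (forall u v : 'I_k, h u v -> u < v ->
       [/\ path g (phi u) (rcons (P u v) (phi v)),
           uniq (P u v),
           size (P u v) <= t &
           forall x, x \in P u v -> forall w, x != phi w]) /\
    (forall u v u' v' : 'I_k, h u v -> u < v -> h u' v' -> u' < v' ->
       (u, v) != (u', v') -> forall x, x \in P u v -> x \notin P u' v').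

Definition simple_graph (k : nat) (h : rel 'I_k) : Prop :=
  (forall u v, h u v = h v u) /\ (forall u, h u u = false).

(* \tilde\nabla_r(G) <= c  (with t = 2r): every r-shallow topological minor H
   of G (simple, nonempty) has density |E(H)|/|V(H)| <= c. *)
Definition tnabla_le (T : finType) (g : rel T) (t : nat) (c : R) : Prop :=
  forall (k : nat) (h : rel 'I_k), 0 < k -> simple_graph h ->
    shallow_top_minor g t h ->
    Rle (Rdiv (INR (num_edges h)) (INR k)) c.

Definition m_of (beta alpha : R) (n : nat) : nat :=
  Z.to_nat (Int_part (Rmult beta (Rpower (INR n) alpha))).

Definition p_of (gamma alpha : R) (n : nat) : R :=
  Rmult gamma (Rpower (INR n) (Ropp (Rdiv (Rplus R1 alpha) (Rplus R1 R1)))).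

(* Main.v *)
Require Import Defs.
From Stdlib Require Import Reals ZArith ClassicalEpsilon Lra Lia.
From mathcomp Require Import all_boot all_order all_algebra.
From mathcomp Require Import boolp Rstruct.

(* A first moment argument.  Since n p = gamma n^((1-alpha)/2), with high
   probability every attribute has at most K = K(alpha) vertices.  Read every
   subdivided edge of a shallow topological minor H as a path of the bipartite
   graph, shortcut so that its attributes are distinct.  As the subdivision
   paths meet only at branch vertices, an attribute occurs in at most K^2 of
   them, so a maximal family of attribute-disjoint paths contains a fraction
   1 / ((t+1) K^2) of all edges of H.  For fixed endpoints, the expected number
   of bipartite paths with l attributes is n^(l-1) m^l p^(2l) = O(1/n), and the
   incidences of attribute-disjoint paths are independent.  Hence the expected
   number of families of c k such paths on k branch vertices is at most
   C(n,k) C(k^2, c k) (D/n)^(c k), where D depends only on t and the constants;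
   for c large in terms of D the sum of these bounds over k >= 1 is O(1/n). *)

Set Implicit Arguments.
Unset Strict Implicit.
Unset Printing Implicit Defensive.

(** * Walks in the bipartite graph *)

Section BipartiteWalks.
Variables n m : nat.
Implicit Types (E I : bipartite n m) (x y z : 'I_n) (a : 'I_m).
Implicit Types (L : seq ('I_m * 'I_n)) (f g : 'I_n * 'I_n).

(* The walk x - a1 - x1 - a2 - x2 - ... in the bipartite graph is stored as its
   start x and the list L = [:: (a1, x1); (a2, x2); ...]. *)
Fixpoint incidences x L : seq ('I_n * 'I_m) :=
  if L is (a, y) :: L' then (x, a) :: (y, a) :: incidences y L' else [::].

Lemma size_incidences x L : size (incidences x L) = (size L).*2.
Proof. by elim: L x => [//|[a y] L IH] x /=; rewrite IH. Qed.

Lemma incidences_cat x L1 L2 :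
  incidences x (L1 ++ L2) =
  incidences x L1 ++ incidences (last x (unzip2 L1)) L2.
Proof. by elim: L1 x => [//|[a y] L1 IH] x /=; rewrite IH. Qed.

Lemma mem_incidences x L z a : (z, a) \in incidences x L -> a \in unzip1 L.
Proof.
elim: L x => [//|[b y] L IH] x /=; rewrite !inE.
by case/or3P => [/eqP[_ ->]|/eqP[_ ->]|/IH ->]; rewrite ?eqxx ?orbT.
Qed.

(** Distinctness makes a walk with l attributes cost exactly 2l bipartite edges, which is the
    exponent of p in the first moment. *)
Lemma uniq_incidences x L :
  uniq (x :: unzip2 L) -> uniq (unzip1 L) -> uniq (incidences x L).
Proof.
elim: L x => [//|[a y] L IH] x /= /andP[xyL yL] /andP[aL uL].
have aNL z : (z, a) \notin incidences y L.
  by apply: contra aL; apply: mem_incidences.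
rewrite !inE negb_or !aNL IH // !andbT.
by move: xyL; rewrite inE negb_or => /andP[xy _]; apply: contra xy => /eqP[->].
Qed.

(** The length of [L] counts attributes, that is, edges of the intersection graph, so [t.+1] is the
    bound 2r+1. Vertices and attributes are both distinct, so [L] is a genuine path of the bipartite
    graph. *)
Definition joins t E f L :=
  [&& 0 < size L <= t.+1, last f.1 (unzip2 L) == f.2, uniq (f.1 :: unzip2 L),
      uniq (unzip1 L) & all (mem E) (incidences f.1 L)].

Lemma split_unzip1 L a : a \in unzip1 L ->
  exists L1 z L2, L = L1 ++ (a, z) :: L2.
Proof.
case/mapP => -[b z] bzL /= ->.
by case/splitPr: bzL => L1 L2; exists L1, z, L2.
Qed.

(* A repeated attribute is shortcut: all its vertices are pairwise adjacent. *)
Lemma igraph_path_walk E x p : path (igraph E) x p -> uniq (x :: p) ->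
  exists L, [/\ last x (unzip2 L) = last x p, subseq (unzip2 L) p,
                uniq (unzip1 L) & all (mem E) (incidences x L)].
Proof.
elim: p x => [|y p IH] x; first by exists [::].
move=> /= /andP[/andP[xy /existsP[a /andP[xa ya]]] yp] /andP[xyp uyp].
have [L [Llast Lsub Luniq LE]] := IH y yp uyp.
have [aL|aL] := boolP (a \in unzip1 L); last first.
  by exists ((a, y) :: L); rewrite /= eqxx; split => //=; rewrite ?aL // xa ya.
have [L1 [z [L2 defL]]] := split_unzip1 aL; subst L.
exists ((a, z) :: L2).
move: Llast Lsub Luniq LE; rewrite /unzip1 /unzip2 !map_cat last_cat /= => Ll Ls.
rewrite cat_uniq incidences_cat all_cat /= => /and3P[_ _ /andP[-> ->]].
move=> /andP[_ /and3P[_ za ->]]; split=> //; last by rewrite /= xa za.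
have Ls2 : subseq (z :: map snd L2) p by apply: subseq_trans Ls; apply: suffix_subseq.
case: ifP => // /eqP zy; rewrite /= in Ls2; subst z.
exact: subseq_trans (subseq_cons _ _) Ls2.
Qed.

(** The set [I] records incidences already exposed, and the walks avoid every attribute occurring in
    it. This form allows the walks to be revealed one at a time by induction on [s]; a minor yields
    the case of empty [I]. *)
Definition linked t E (I : bipartite n m) (s : seq ('I_n * 'I_n)) : Prop :=
  I \subset E /\
  exists w : 'I_n * 'I_n -> seq ('I_m * 'I_n),
    [/\ forall f, f \in s -> joins t E f (w f),
        forall f a x, f \in s -> a \in unzip1 (w f) -> (x, a) \notin I &
        forall f g a, f \in s -> g \in s -> f != g ->
          a \in unzip1 (w f) -> a \notin unzip1 (w g)].

End BipartiteWalks.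

(** * Attribute-disjoint paths from a dense shallow minor *)

Lemma leq_card_cover_const (T U : finType) (A : {set T}) (F : T -> {set U}) N :
  (forall x, x \in A -> #|F x| <= N) -> #|\bigcup_(x in A) F x| <= #|A| * N.
Proof.
move=> FN; rewrite -sum_nat_const.
apply: (@leq_trans (\sum_(x in A) #|F x|)); last exact: leq_sum.
elim/big_rec2: _ => [|x k B _ IH]; first by rewrite cards0.
by apply: leq_trans (leq_card_setU _ _) _; rewrite leq_add2l.
Qed.

Section ShallowMinor.
Variables (n m t K k : nat) (E : bipartite n m) (h : rel 'I_k).
Hypothesis minor : shallow_top_minor (igraph E) t h.
Hypothesis attr_small : forall a : 'I_m, #|[set x | (x, a) \in E]| <= K.

Local Notation hedges :=
  [set uv : 'I_k * 'I_k | h uv.1 uv.2 && (uv.1 < uv.2)].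

(** The subsequence clause keeps track of where the vertices of a shortcut walk come from. A vertex
    of [Q e] is internal to one subdivision path only, so a step of a walk can later identify its
    edge. *)
Lemma minor_walks : exists (phi : 'I_k -> 'I_n)
    (w : 'I_k * 'I_k -> seq ('I_m * 'I_n))
    (Q : 'I_k * 'I_k -> seq 'I_n),
  [/\ injective phi,
      forall e, e \in hedges -> joins t E (phi e.1, phi e.2) (w e) /\
        subseq (unzip2 (w e)) (rcons (Q e) (phi e.2)),
      forall e x, e \in hedges -> x \in Q e -> forall u, x != phi u &
      forall e e' x, e \in hedges -> e' \in hedges -> x \in Q e -> x \in Q e' ->
        e = e'].
Proof.
case: minor => phi [P [phi_inj [Ppath Pdisj]]].
have walk e : exists L, e \in hedges -> joins t E (phi e.1, phi e.2) L /\
    subseq (unzip2 L) (rcons (P e.1 e.2) (phi e.2)).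
  case: (boolP (e \in hedges)); last by exists [::].
  rewrite inE => /andP[he lte].
  have [Pp Pu Ps Pphi] := Ppath _ _ he lte.
  have phiNP u : phi u \notin P e.1 e.2.
    by apply/negP => /Pphi/(_ u); rewrite eqxx.
  have phi12 : phi e.1 != phi e.2.
    by apply/eqP => /phi_inj E12; move: lte; rewrite E12 ltnn.
  have uP : uniq (phi e.1 :: rcons (P e.1 e.2) (phi e.2)).
    by rewrite /= mem_rcons inE negb_or phi12 rcons_uniq !phiNP Pu.
  have [L [Ll Ls Lu LE]] := igraph_path_walk Pp uP.
  exists L => _; split=> //; rewrite /joins Ll last_rcons eqxx Lu LE !andbT.
  move: (size_subseq Ls); rewrite size_rcons size_map => sL.
  rewrite (leq_trans sL) // andbT; apply/andP; split.
    case: (L) Ll => //= /eqP; rewrite last_rcons => /eqP E12.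
    by rewrite E12 eqxx in phi12.
  apply: subseq_uniq uP; rewrite [(phi e.1, phi e.2).1]/=.
  by rewrite -cat1s -[_ :: rcons _ _]cat1s cat_subseq.
have [w wP] := boolp.choice walk.
exists phi, w, (fun e => P e.1 e.2); split => //.
- by move=> e x; rewrite inE => /andP[he lte] xP; have [_ _ _ /(_ x xP)] := Ppath _ _ he lte.
- move=> [u v] [u' v'] x; rewrite !inE /= => /andP[he lte] /andP[he' lte'] xP xP'.
  apply/eqP/negPn/negP => ne.
  by have := Pdisj _ _ _ _ he lte he' lte' ne x xP; rewrite xP'.
Qed.

(** Let [M] be a maximal set of edges whose walks are attribute-disjoint. Its at most (t+1)|M|
    attributes [AM] meet the walk of every edge. Sending an edge to a step of its walk through [AM]
    is injective, and an attribute supports at most K^2 steps, so [h] has at most (t+1) K^2 |M|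
    edges. *)
Lemma linked_subgraph c : 0 < k -> c * k * (t.+1 * K ^ 2) < num_edges h ->
  exists (W : {set 'I_n}) (F : {set 'I_n * 'I_n}),
    [/\ #|W| = k, F \subset setX W W, #|F| = c * k & linked t E set0 (enum F)].
Proof.
move=> k_gt0 dense.
have [phi [w [Q [phi_inj wP QNphi Qdisj]]]] := minor_walks.
pose attrs e := [set a in unzip1 (w e)].
pose ok (S : {set 'I_k * 'I_k}) := (S \subset hedges) &&
  [forall e in S, forall e' in S, (e != e') ==> [disjoint attrs e & attrs e']].
have ok0 : exists S, ok S.
  by exists set0; rewrite /ok sub0set; apply/forall_inP => e; rewrite inE.
have [M /maxsetP[/andP[/subsetP Mh Mdisj] Mmax]] := ex_maxset ok0.
pose AM := \bigcup_(e in M) attrs e.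
have cardAM : #|AM| <= #|M| * t.+1.
  apply: leq_card_cover_const => e /Mh /wP[/and5P[/andP[_ sw] _ _ _ _] _].
  apply: leq_trans sw; rewrite -(size_map fst) cardsE; exact: card_size.
have hitAM e : e \in hedges -> exists2 a, a \in unzip1 (w e) & a \in AM.
  move=> eh; have [eM|eM] := boolP (e \in M).
    have [/and5P[/andP[]]] := wP e eh.
    case dw: (w e) => [//|[a z] L] _ _ _ _ _ _ _; exists a; first by rewrite inE eqxx.
    by apply/bigcupP; exists e; rewrite // inE dw inE eqxx.
  (* Otherwise [e] could be added to [M], against maximality. *)
  apply: NNPP => nohit.
  have disj e' : e' \in M -> [disjoint attrs e & attrs e'].
    move=> e'M; apply/pred0P => a /=; apply/negP => /andP[]; rewrite inE => ae ae'.
    by apply: nohit; exists a => //; apply/bigcupP; exists e'.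
  have okeM : ok (e |: M).
    rewrite /ok subUset sub1set eh /=; apply/andP; split; first exact/subsetP.
    apply/forall_inP => e1 /setU1P[->|e1M]; apply/forall_inP => e2 /setU1P[->|e2M].
    - by rewrite eqxx.
    - by apply/implyP => _; apply: disj.
    - by apply/implyP => _; rewrite disjoint_sym; apply: disj.
    - by have /forall_inP/(_ e2 e2M) := forall_inP Mdisj e1 e1M.
  by rewrite -(Mmax _ okeM (subsetUr _ _)) setU11 in eM.
have stepAM e : e \in hedges -> exists s : 'I_m * ('I_n * 'I_n),
    [/\ s.1 \in AM, (s.2.1, s.1) \in E, (s.2.2, s.1) \in E,
        s.2.1 \in phi e.1 :: Q e & s.2.2 \in rcons (Q e) (phi e.2)].
  move=> eh; have [a aw aM] := hitAM e eh.
  have [/and5P[_ /eqP wl wu _ wE] wQ] := wP e eh.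
  have [L1 [z [L2 dw]]] := split_unzip1 aw.
  pose x := last (phi e.1) (unzip2 L1); exists (a, (x, z)).
  move: wl wu wE wQ; rewrite dw incidences_cat all_cat /= /unzip2 !map_cat last_cat /=.
  move=> wl /andP[_ wu] /and4P[_ xE zE _] wQ.
  have xL : x \in phi e.1 :: map snd L1 by apply: mem_last.
  split=> //=.
    move: xL; rewrite !inE => /orP[->//|xL].
    have : x \in rcons (Q e) (phi e.2) by apply: (mem_subseq wQ); rewrite mem_cat xL.
    rewrite mem_rcons inE => /orP[/eqP xe|->]; last by rewrite orbT.
    (* The step cannot start at [phi e.2], which is the last vertex of the walk and would then occur
       twice. *)
    move: wu; rewrite cat_uniq => /and3P[_ /hasP[]].
    by exists x => //; rewrite xe -wl; apply: mem_last.
  by apply: (mem_subseq wQ); rewrite mem_cat inE eqxx orbT.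
(* The step of some edge [e0] serves as default value outside [hedges], so that a total choice
   function exists. *)
have [e0 e0h] : exists e0, e0 \in hedges.
  by apply/set0Pn; rewrite -card_gt0; apply: leq_ltn_trans dense.
have [s0 _] := stepAM e0 e0h.
have {}stepAM e : exists s : 'I_m * ('I_n * 'I_n), e \in hedges ->
    [/\ s.1 \in AM, (s.2.1, s.1) \in E, (s.2.2, s.1) \in E,
        s.2.1 \in phi e.1 :: Q e & s.2.2 \in rcons (Q e) (phi e.2)].
  have [eh|_] := boolP (e \in hedges); last by exists s0.
  by have [s sP] := stepAM e eh; exists s.
have [step stepP] := boolp.choice stepAM.
(* If an end of the step is internal to a subdivision path, that vertex determines the edge.
   Otherwise the step runs from [phi e.1] to [phi e.2], and injectivity of [phi] recovers both
   ends. *)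
have step_inj : {in hedges &, injective step}.
  move=> e e' eh e'h se; have [_ _ _ x1 z1] := stepP e eh.
  have [_ _ _ ] := stepP e' e'h; rewrite -se.
  move: x1 z1; rewrite !mem_rcons !inE.
  case/orP => [/eqP->|xQ]; last first.
    move=> _ /orP[/eqP xphi|xQ' _]; last exact: Qdisj xQ xQ'.
    by have := QNphi _ _ eh xQ e'.1; rewrite xphi eqxx.
  case/orP => [/eqP->|zQ]; last first.
    move=> _ /orP[/eqP zphi|zQ']; last exact: Qdisj zQ zQ'.
    by have := QNphi _ _ eh zQ e'.2; rewrite zphi eqxx.
  case/orP=> [/eqP/phi_inj e1|xQ']; last by have := QNphi _ _ e'h xQ' e.1; rewrite eqxx.
  case/orP=> [/eqP/phi_inj e2|zQ']; last by have := QNphi _ _ e'h zQ' e.2; rewrite eqxx.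
  by apply/eqP; rewrite -pair_eqE /pair_eq e1 e2 !eqxx.
have card_hedges : num_edges h <= #|AM| * K ^ 2.
  rewrite -[num_edges h](card_in_imset step_inj).
  pose V a := [set x | (x, a) \in E].
  have cover : #|\bigcup_(a in AM) setX [set a] (setX (V a) (V a))| <= #|AM| * K ^ 2.
    apply: leq_card_cover_const => a _.
    by rewrite !cardsX cards1 mul1n -mulnn leq_mul ?attr_small.
  apply: leq_trans cover; apply/subset_leq_card/subsetP => _ /imsetP[e eh ->].
  have [aM xE zE _ _] := stepP e eh; apply/bigcupP; exists (step e).1 => //.
  by rewrite !inE eqxx xE zE.
have ckM : c * k <= #|M|.
  rewrite leqNgt; apply/negP => /ltnW Mck; move: dense; rewrite ltnNge => /negP[].
  apply: leq_trans card_hedges _; rewrite mulnA leq_mul2r.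
  by rewrite (leq_trans cardAM) ?orbT // leq_mul2r Mck orbT.
have [s [us ss sM]] := card_geqP ckM.
pose img (e : 'I_k * 'I_k) := (phi e.1, phi e.2).
have img_inj : injective img by move=> [u v] [u' v'] [/phi_inj -> /phi_inj ->].
(* A left inverse of [phi]; the default 0 is taken only off the image of [phi]. *)
pose psi x := odflt (Ordinal k_gt0) [pick u | phi u == x].
have phiK : cancel phi psi.
  move=> u; rewrite /psi; case: pickP => [v /eqP/phi_inj //|/(_ u)]; by rewrite eqxx.
pose inv (f : 'I_n * 'I_n) := (psi f.1, psi f.2).
have imgK : cancel img inv by move=> [u v]; rewrite /inv /= !phiK.
exists (phi @: setT), (img @: [set e in s]); split.
- by rewrite card_imset // cardsT card_ord.
- by apply/subsetP => _ /imsetP[e _ ->]; rewrite in_setX !imset_f.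
- by rewrite card_imset // cardsE (card_uniqP us).
split; first exact: sub0set.
have imgs f : f \in enum (img @: [set e in s]) -> exists2 e, e \in M & f = img e.
  by rewrite mem_enum => /imsetP[e]; rewrite inE => /sM; exists e.
exists (w \o inv); split.
- by move=> _ /imgs[e eM ->] /=; rewrite imgK; case: (wP e (Mh _ eM)).
- by move=> f a x _ _; rewrite inE.
- move=> _ _ a /imgs[e eM ->] /imgs[e' e'M ->] ne /=; rewrite !imgK => ae.
  have /forall_inP/(_ e' e'M)/implyP := forall_inP Mdisj e eM.
  move=> /(_ (contra_neq (@congr1 _ _ img _ _) ne)) /pred0P/(_ a) /=.
  by rewrite !inE ae /= => ->.
Qed.
End ShallowMinor.

(** * Asymptotics of the parameters *)

Section Asymptotics.
Local Open Scope R_scope.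
Variables alpha beta gamma : R.
Hypotheses (alpha_gt1 : 1 < alpha) (beta_gt0 : 0 < beta) (gamma_gt0 : 0 < gamma).

Lemma m_of_le n : INR (m_of beta alpha n) <= beta * Rpower (INR n) alpha.
Proof.
rewrite /m_of; set r := beta * _.
have r_ge0 : 0 <= r by apply: Rmult_le_pos; [lra | apply/Rlt_le/exp_pos].
have [fl fl1] := base_Int_part r.
(* Nonnegativity ensures that [Z.to_nat] does not truncate the integer part. *)
have fl_ge0 : Z.le Z0 (Int_part r).
  have : Z.lt (Zneg xH) (Int_part r) by apply: lt_IZR; lra.
  by lia.
by rewrite INR_IZR_INZ Z2Nat.id.
Qed.

Lemma p_of_ge0 n : 0 <= p_of gamma alpha n.
Proof. by apply: Rmult_le_pos; [lra | apply/Rlt_le/exp_pos]. Qed.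

Lemma Rpower_opp1 x : 0 < x -> Rpower x (- (1)) = / x.
Proof. by move=> x_gt0; rewrite Rpower_Ropp Rpower_1. Qed.

(** The exponent (1+alpha)/2 exceeds 1. For large n this makes p at most 1, hence a probability. *)
Lemma p_of_le n : (0 < n)%N -> p_of gamma alpha n <= gamma * / INR n.
Proof.
move=> /ltP/lt_INR n_gt0; rewrite /= in n_gt0.
have n_ge1 : 1 <= INR n.
  by apply: (le_INR 1); apply: INR_lt; rewrite /=.
apply: Rmult_le_compat_l; first lra.
rewrite -Rpower_opp1 //; apply: Rle_Rpower => //; lra.
Qed.

Lemma n_m_p2_le n : (0 < n)%N ->
  INR n * INR (m_of beta alpha n) * p_of gamma alpha n ^ 2 <= beta * gamma ^ 2.
Proof.
move=> /ltP/lt_INR n_gt0; rewrite /= in n_gt0.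
have mle := m_of_le n.
apply: (Rle_trans _ (INR n * (beta * Rpower (INR n) alpha) * p_of gamma alpha n ^ 2)).
  apply: Rmult_le_compat_r; first exact: pow2_ge_0.
  by apply: Rmult_le_compat_l; lra.
rewrite /p_of Rpow_mult_distr -(@Rpower_pow 2 (Rpower _ _)); last exact: exp_pos.
rewrite Rpower_mult -{1}(Rpower_1 (INR n)) //.
set a := Rpower _ 1; set b := Rpower _ alpha; set d := Rpower _ _.
have -> : a * (beta * b) * (gamma ^ 2 * d) = beta * gamma ^ 2 * (a * b * d) by ring.
rewrite /a /b /d -!Rpower_plus.
have -> : 1 + alpha + - ((1 + alpha) / (1 + 1)) * INR 2 = 0 by rewrite /=; field.
rewrite Rpower_O //; lra.
Qed.

(** As n p = gamma n^((1-alpha)/2), the K-th power contributes n to the power -(alpha-1)K/2, at most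
    -(alpha+1). This absorbs n^alpha from m and leaves a factor 1/n. *)
Lemma m_np_pow_le n K : (0 < n)%N -> alpha + 1 <= (alpha - 1) / 2 * INR K ->
  INR (m_of beta alpha n) * (INR n * p_of gamma alpha n) ^ K <=
  beta * gamma ^ K * / INR n.
Proof.
move=> /ltP/lt_INR n_gt0 alphaK; rewrite /= in n_gt0.
have n_ge1 : 1 <= INR n.
  by apply: (le_INR 1); apply: INR_lt; rewrite /=.
have mle := m_of_le n.
have np_ge0 : 0 <= INR n * p_of gamma alpha n.
  by apply: Rmult_le_pos; [lra | apply: p_of_ge0].
apply: (Rle_trans _ (beta * Rpower (INR n) alpha * (INR n * p_of gamma alpha n) ^ K)).
  by apply: Rmult_le_compat_r => //; apply: pow_le.
have -> : INR n * p_of gamma alpha n = gamma * Rpower (INR n) ((1 - alpha) / 2).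
  rewrite /p_of -{1}(Rpower_1 (INR n)) // Rmult_comm Rmult_assoc -Rpower_plus.
  by congr (_ * Rpower _ _); field.
rewrite Rpow_mult_distr -(@Rpower_pow K (Rpower _ _)); last exact: exp_pos.
rewrite Rpower_mult.
set b := Rpower _ alpha; set d := Rpower _ _.
have -> : beta * b * (gamma ^ K * d) = beta * gamma ^ K * (b * d) by ring.
apply: Rmult_le_compat_l.
  by apply: Rmult_le_pos; [lra | apply: pow_le; lra].
rewrite /b /d -Rpower_plus -Rpower_opp1 //; apply: Rle_Rpower => //; lra.
Qed.

End Asymptotics.

From mathcomp Require Import ring lra.
Import Order.TTheory GRing.Theory Num.Theory.
Local Open Scope ring_scope.

(** * Probability estimates *)

Section Probability.
Variables (n m : nat) (p : R).
Hypothesis p01 : 0 <= p <= 1.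
Implicit Types (P Q : bipartite n m -> Prop) (E I : bipartite n m).

Lemma bip_weightE E : bip_weight p E = \prod_i (if i \in E then p else 1 - p).
Proof.
rewrite /bip_weight !RpowE (bigID (mem E)) /= RmultE; congr (_ * _).
  by rewrite -prodr_const; apply: eq_bigr => i ->.
rewrite (eq_bigr (fun=> 1 - p)) => [|i /negbTE -> //].
have -> : (n * m - #|E|)%N = #|~: E| by rewrite [RHS]cardsCs setCK card_prod !card_ord.
by rewrite -prodr_const; apply: eq_bigl => i; rewrite inE.
Qed.

Lemma bip_weight_ge0 E : 0 <= bip_weight p E.
Proof.
case/andP: p01 => p0 p1; rewrite bip_weightE; apply: prodr_ge0 => i _.
by case: ifP; rewrite ?subr_ge0.
Qed.

Lemma probE P : prob p P = \sum_E `[< P E >]%:R * bip_weight p E.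
Proof.
apply: eq_bigr => E _; case: excluded_middle_informative => H.
  by rewrite asboolT // mul1r.
by rewrite asboolF // mul0r.
Qed.

(** The product over all incidences of (weight if present + weight if absent), with weight 0 for
    absence inside [I], expands into the sum over all [E]. *)
Lemma prob_subset I : prob p (fun E => I \subset E) = p ^+ #|I|.
Proof.
transitivity (\prod_i (p + (if i \in I then 0 else 1 - p))); last first.
  rewrite -prodr_const [RHS]big_mkcond; apply: eq_bigr => i _.
  by case: ifP; rewrite ?addr0 // addrC subrK.
rewrite probE bigA_distr; apply: eq_bigr => E _; rewrite bip_weightE asboolb.
have [IE|/subsetPn[i iI /negbTE iE]] := boolP (I \subset E).
  rewrite mul1r; apply: eq_bigr => i _.
  by case: ifP => // iE; case: ifP => // /(subsetP IE); rewrite iE.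
by rewrite mul0r (bigD1 i) //= iE iI mul0r.
Qed.

Lemma prob_union (J : finType) (A : pred J) P (Q : J -> bipartite n m -> Prop) :
  (forall E, P E -> exists2 j, A j & Q j E) ->
  prob p P <= \sum_(j | A j) prob p (Q j).
Proof.
move=> PQ; rewrite probE (eq_bigr _ (fun j _ => probE (Q j))) exchange_big /=.
apply: ler_sum => E _; rewrite -mulr_suml ler_wpM2r ?bip_weight_ge0 //.
have [PE|nPE] := pselect (P E); last by rewrite asboolF // sumr_ge0.
have [j Aj QjE] := PQ E PE.
by rewrite asboolT // (bigD1 j Aj) /= asboolT // lerDl sumr_ge0.
Qed.

Lemma prob_mono P Q : (forall E, P E -> Q E) -> prob p P <= prob p Q.
Proof.
move=> PQ; rewrite !probE; apply: ler_sum => E _; rewrite ler_wpM2r ?bip_weight_ge0 //.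
by case: (asboolP (P E)) => [/PQ PE|//]; rewrite asboolT.
Qed.

Lemma probT : prob p (fun _ : bipartite n m => True) = 1.
Proof.
rewrite -[RHS](expr0 p) -(cards0 ('I_n * 'I_m)%type) -prob_subset !probE.
by apply: eq_bigr => E _; rewrite !asboolT ?sub0set.
Qed.

Lemma prob_le1 P : prob p P <= 1.
Proof. by rewrite -probT; apply: prob_mono. Qed.

Lemma probC P : prob p P = 1 - prob p (fun E => ~ P E).
Proof.
rewrite -probT !probE -sumrB; apply: eq_bigr => E _; rewrite -mulrBl (asboolT Logic.I).
by congr (_ * _); rewrite asbool_neg; case: asboolP => _; rewrite ?subr0 ?subrr.
Qed.

(** Union bound over the walk of the first pair. Its incidences are added to [I]; they are new
    because its attributes do not occur in [I], and the other walks avoid these attributes, so the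
    induction hypothesis applies to the enlarged set. This takes the place of an explicit
    independence argument. *)
Lemma prob_linked t I s : uniq s ->
  prob p (fun E => linked t E I s) <=
  p ^+ #|I| * (\sum_(l < t.+1) (m * n)%:R ^+ l * m%:R * p ^+ l.+1.*2) ^+ size s.
Proof.
have p_ge0 : 0 <= p by case/andP: p01.
set B := \sum_(l < _) _.
have B_ge0 : 0 <= B.
  apply: sumr_ge0 => l _; apply: mulr_ge0; last exact: exprn_ge0.
  by apply: mulr_ge0 => //; apply: exprn_ge0.
elim: s I => [|f s IH] I.
  by rewrite expr0 mulr1 -prob_subset => _; apply: prob_mono => E [].
move=> /andP[fs us].
(* The last vertex is forced to be [f.2], so a walk with l+1 attributes has only l free vertices:
   (mn)^l m candidates. *)
pose walk l (La : l.-tuple ('I_m * 'I_n) * 'I_m) := rcons La.1 (La.2, f.2).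
pose grow w := I :|: [set i in incidences f.1 w].
pose valid w := [&& uniq (f.1 :: unzip2 w), uniq (unzip1 w) &
  [forall a, forall x, (a \in unzip1 w) ==> ((x, a) \notin I)]].
pose next l La E := valid (walk l La) /\ linked t E (grow (walk l La)) s.
apply: (@le_trans _ _ (\sum_(l < t.+1) \sum_(La : l.-tuple ('I_m * 'I_n) * 'I_m)
                          prob p (next l La))).
  apply: (@le_trans _ _ (\sum_(l < t.+1) prob p (fun E => exists La, next l La E))).
    apply: prob_union => E [IE [w [wj wI wd]]].
    have /and5P[/andP[w_gt0 w_le] wl wu wa wE] := wj f (mem_head _ _).
    case/lastP dw: (w f) w_gt0 w_le wl => [//|L [a y]] _.
    rewrite size_rcons ltnS -[(_ <= _)%N]ltnS => Lt.
    rewrite /unzip2 map_rcons last_rcons /= => /eqP yf; subst y.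
    exists (Ordinal Lt) => //=; exists (in_tuple L, a).
    rewrite /next /walk /= -dw; split.
      rewrite /valid wu wa /=; apply/forallP => b; apply/forallP => x.
      by apply/implyP; apply: wI; rewrite mem_head.
    split.
      rewrite subUset IE /=; apply/subsetP => i; rewrite inE => iw.
      exact: (allP wE).
    exists w; split.
    - by move=> g gs; apply: wj; rewrite inE gs orbT.
    - move=> g b x gs bg; rewrite inE negb_or (wI g) ?inE ?gs ?orbT //=.
      apply: contraTN (bg) => /mem_incidences bf; apply: wd bf.
      + exact: mem_head.
      + by rewrite inE gs orbT.
      + by apply: contraNneq fs => ->.
    - by move=> g g' b gs g's; apply: wd; rewrite inE ?gs ?g's orbT.
  by apply: ler_sum => l _; apply: prob_union => E [La]; exists La.
have -> : p ^+ #|I| * B ^+ size (f :: s) = \sum_(l < t.+1)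
    \sum_(La : l.-tuple ('I_m * 'I_n) * 'I_m) p ^+ (#|I| + l.+1.*2) * B ^+ size s.
  rewrite exprS mulrA [p ^+ _ * B]mulrC !mulr_suml; apply: eq_bigr => l _.
  rewrite sumr_const card_prod card_tuple card_prod !card_ord.
  by rewrite -[RHS]mulr_natl [X in _ = X * _]natrM natrX exprD; ring.
apply: ler_sum => l _; apply: ler_sum => La _.
have [valLa|invalid] := boolP (valid (walk l La)); last first.
  apply: (@le_trans _ _ 0); last by rewrite mulr_ge0 ?exprn_ge0.
  by rewrite probE big1 // => E _; rewrite asboolF ?mul0r // => -[]; rewrite (negbTE invalid).
apply: (@le_trans _ _ (prob p (fun E => linked t E (grow (walk l La)) s))).
  by apply: prob_mono => E [].
apply: le_trans (IH _ us) _; rewrite le_eqVlt; apply/orP; left; apply/eqP.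
congr (p ^+ _ * _); case/and3P: valLa => wu wa /forallP wI.
(* By validity the walk is disjoint from [I], so exactly 2(l+1) incidences are added. *)
rewrite /grow cardsU [X in (_ - X)%N](_ : _ = 0%N); last first.
  apply: eq_card0 => -[x a]; rewrite !inE; apply/negP => /andP[xaI /mem_incidences aw].
  by have /forallP/(_ x)/implyP/(_ aw) := wI a; rewrite xaI.
rewrite subn0 cardsE (card_uniqP (uniq_incidences wu wa)) size_incidences.
by rewrite size_rcons size_tuple.
Qed.

(** Union bound over an attribute and K+1 distinct vertices incident to it. *)
Lemma prob_attribute_large K :
  prob p (fun E => exists a : 'I_m, (K < #|[set x | (x, a) \in E]|)%N) <=
  m%:R * (n%:R * p) ^+ K.+1.
Proof.
have p_ge0 : 0 <= p by case/andP: p01.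
pose inc (aL : 'I_m * K.+1.-tuple 'I_n) := [set (x, aL.1) | x in aL.2].
apply: (@le_trans _ _ (\sum_(aL : 'I_m * K.+1.-tuple 'I_n | uniq aL.2)
    prob p (fun E => inc aL \subset E))).
  apply: prob_union => E [a /card_geqP[s [us ss sE]]].
  have sK : size s == K.+1 by rewrite ss.
  exists (a, Tuple sK) => //=; apply/subsetP => _ /imsetP[x xs ->] /=.
  by have := sE x xs; rewrite inE.
rewrite (eq_bigr (fun=> p ^+ K.+1)) => [|[a L] /= uL]; last first.
  rewrite prob_subset card_imset => [|x y [] //].
  by rewrite (card_uniqP uL) size_tuple.
rewrite sumr_const -[leLHS]mulr_natl exprMn mulrA; apply: ler_wpM2r; first exact: exprn_ge0.
rewrite -natrX -natrM ler_nat; apply: leq_trans (max_card _) _.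
by rewrite card_prod card_tuple !card_ord.
Qed.

End Probability.

(** * Binomial estimates and the first moment sum *)

Lemma expn_leq_ffact N j i : (i <= j)%N -> ((N - j) ^ i <= N ^_ i)%N.
Proof.
elim: i => [//|i IH] ij; rewrite expnSr ffactnSr.
by apply: leq_mul; [apply: IH (ltnW ij) | apply/leq_sub2l/ltnW].
Qed.

Lemma bin_leq_expn2 N j : ('C(N, j) <= 2 ^ N)%N.
Proof.
rewrite -[N in 'C(N, _)]card_ord -card_draws -[N in (2 ^ N)%N]card_ord.
rewrite -cardsT -card_powerset; apply/subset_leq_card/subsetP => A _.
by rewrite powersetE subsetT.
Qed.

(** An elementary substitute for Stirling: j^j is at most the falling factorial (2j)(2j-1)...(j+1) =
    C(2j,j) j!, and C(2j,j) is at most 4^j. *)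
Lemma expnn_leq_fact j : (j ^ j <= 4 ^ j * j`!)%N.
Proof.
have := @expn_leq_ffact j.*2 j j (leqnn j).
rewrite -addnn addnK addnn => /leq_trans; apply.
by rewrite -bin_ffact leq_mul2r -[4%N]/(2 ^ 2)%N -expnM mul2n bin_leq_expn2 orbT.
Qed.

Lemma ffact_leq_expn N j : (N ^_ j <= N ^ j)%N.
Proof. by elim: j => [//|j IH]; rewrite ffactnSr expnSr leq_mul // leq_subr. Qed.

Lemma bin_leq_pow N j : ('C(N, j) * j ^ j <= (4 * N) ^ j)%N.
Proof.
apply: leq_trans (leq_mul (leqnn _) (expnn_leq_fact j)) _.
by rewrite mulnCA bin_ffact expnMn leq_mul // ffact_leq_expn.
Qed.

Lemma bin_le_pow (F : realFieldType) N j :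
  (0 < j)%N -> 'C(N, j)%:R <= (4 * N%:R / j%:R) ^+ j :> F.
Proof.
move=> j_gt0; rewrite expr_div_n ler_pdivlMr ?exprn_gt0 ?ltr0n //.
by rewrite -natrM -!natrX -natrM ler_nat bin_leq_pow.
Qed.

Lemma sum_half_pow (F : realFieldType) N :
  \sum_(k < N) k%:R * 2^-1 ^+ k <= 2 :> F.
Proof.
suff -> : \sum_(k < N) k%:R * 2^-1 ^+ k = 2 - N.+1%:R * 2 * 2^-1 ^+ N :> F.
  by rewrite lerBlDr lerDl !mulr_ge0 // exprn_ge0 // invr_ge0.
elim: N => [|N IH]; first by rewrite big_ord0 expr0; ring.
by rewrite big_ord_recr /= IH exprS -[N.+2]addn2 -[N.+1]addn1 !natrD; field.
Qed.

(** With x = k/n and y = 4D/c, the left side is at most (4/x (xy)^c)^k. Since c is at least 3, x at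
    most 1 and y at most 1/2, the base is at most 4 x^2 y^3, hence at most x/2. One factor x from
    x^k is kept and supplies k/n. *)
Lemma first_moment_term (F : realFieldType) (D : F) (n k c : nat) :
  0 <= D -> (2 < c)%N -> 8 * D <= c%:R -> (0 < k <= n)%N ->
  'C(n, k)%:R * 'C(k * k, c * k)%:R * (D / n%:R) ^+ (c * k)
    <= k%:R * 2^-1 ^+ k / n%:R.
Proof.
move=> D_ge0 c_gt2 Dc /andP[k_gt0 kn].
have n_gt0 : (0 < n)%N by apply: leq_trans kn.
have c_gt0 : (0 < c)%N by apply: leq_trans c_gt2.
have [nR kR cR] : [/\ 0 < n%:R :> F, 0 < k%:R :> F & 0 < c%:R :> F].
  by rewrite !ltr0n.
pose x : F := k%:R / n%:R; pose y : F := 4 * D / c%:R.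
have x_gt0 : 0 < x by rewrite divr_gt0.
have x_le1 : x <= 1 by rewrite ler_pdivrMr // mul1r ler_nat.
have y_ge0 : 0 <= y by rewrite divr_ge0 ?mulr_ge0 // ltW.
have y_le : y <= 2^-1 by rewrite ler_pdivrMr //; lra.
apply: (@le_trans _ _ ((4 * n%:R / k%:R) ^+ k *
    (4 * (k * k)%:R / (c * k)%:R) ^+ (c * k) * (D / n%:R) ^+ (c * k))).
  apply: ler_wpM2r; first by rewrite exprn_ge0 // divr_ge0 // ltW.
  by apply: ler_pM => //; apply: bin_le_pow; rewrite ?muln_gt0 ?c_gt0.
have -> : (4 * n%:R / k%:R) ^+ k * (4 * (k * k)%:R / (c * k)%:R) ^+ (c * k)
     * (D / n%:R) ^+ (c * k) = (4 / x * (x * y) ^+ c) ^+ k.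
  rewrite -mulrA -exprMn !exprM -exprMn /x /y; congr (_ ^+ _); congr (_ * _ ^+ _).
    by field; rewrite !gt_eqF.
  by rewrite !natrM; field; rewrite !gt_eqF.
have base : 4 / x * (x * y) ^+ c <= x / 2.
  apply: (@le_trans _ _ (4 / x * (x * y) ^+ 3)).
    rewrite ler_pM2l ?divr_gt0 //; apply: ler_wiXn2l => //.
      by rewrite mulr_ge0 // ltW.
    by rewrite -[1]mulr1 ler_pM //; lra.
  have -> : 4 / x * (x * y) ^+ 3 = 4 * x ^+ 2 * y ^+ 3 by field; rewrite gt_eqF.
  have -> : x / 2 = 4 * x * 2^-1 ^+ 3 by field.
  apply: ler_pM; first by rewrite mulr_ge0 ?sqr_ge0.
  - exact: exprn_ge0.
  - by rewrite ler_pM2l // expr2 ler_piMr // ltW.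
  - by rewrite lerXn2r // nnegrE; lra.
apply: (@le_trans _ _ ((x / 2) ^+ k)).
  have x_ge0 := ltW x_gt0.
  by rewrite lerXn2r // nnegrE ?mulr_ge0 ?exprn_ge0 ?mulr_ge0 ?invr_ge0.
rewrite exprMn -mulrA [_ / n%:R]mulrC mulrA -/x ler_pM2r ?exprn_gt0 ?invr_gt0 //.
by rewrite -[leRHS]expr1 ler_wiXn2l // ltW.
Qed.

(** * Probability of a dense shallow minor *)

Lemma prob_dense_minor (n m t K c : nat) (p D : R) :
  (0 < n)%N -> 0 <= p <= 1 -> 1 <= D -> n%:R * m%:R * p ^+ 2 <= D ->
  (2 < c)%N -> 8 * (t.+1%:R * D ^+ t.+1) <= c%:R ->
  prob p (fun E : bipartite n m =>
            ~ tnabla_le (igraph E) t (c * (t.+1 * K ^ 2))%:R) <=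
  m%:R * (n%:R * p) ^+ K.+1 + 2 / n%:R.
Proof.
move=> n_gt0 p01 D_ge1 mpD c_gt2 Dc.
have p_ge0 : 0 <= p by case/andP: p01.
have nR : 0 < n%:R :> R by rewrite ltr0n.
pose large (E : bipartite n m) :=
  exists a : 'I_m, (K < #|[set x | (x, a) \in E]|)%N.
pose dense (k : nat) (W : {set 'I_n}) (E : bipartite n m) :=
  exists2 F : {set 'I_n * 'I_n}, (F \subset setX W W) && (#|F| == c * k)%N &
    linked t E set0 (enum F).
(* Indexing by [bool] turns [prob_union] into a bound for two events: a large attribute, or a linked
   family on k branch vertices with k at most n. *)
pose event (b : bool) E := if b then large E else
  exists2 k : 'I_n.+1, (0 < k)%N & exists2 W : {set 'I_n}, #|W| == k & dense k W E.
apply: (@le_trans _ _ (\sum_(b : bool) prob p (event b))).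
  apply: prob_union => // E; rewrite /tnabla_le => /existsNP[k] /existsNP[h].
  move=> /not_implyP[k_gt0] /not_implyP[_] /not_implyP[minor] /RleP.
  rewrite RdivE !INRE -ltNge ltr_pdivlMr ?ltr0n // -natrM ltr_nat => edges.
  have [lE|nlE] := pselect (large E); first by exists true.
  exists false => //=.
  have small a : (#|[set x | (x, a) \in E]| <= K)%N.
    by rewrite leqNgt; apply/negP => aK; apply: nlE; exists a.
  have edges' : (c * k * (t.+1 * K ^ 2) < num_edges h)%N.
    by rewrite mulnAC.
  have [W [F [Wk FW Fk Flink]]] := linked_subgraph minor small k_gt0 edges'.
  have kn : (k < n.+1)%N by rewrite ltnS -Wk -[leqRHS]card_ord max_card.
  exists (Ordinal kn) => //; exists W; rewrite ?Wk //=; exists F => //.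
  by rewrite FW Fk /=.
rewrite big_bool /=; apply: lerD; first exact: prob_attribute_large.
set B := \sum_(l < t.+1) (m * n)%:R ^+ l * m%:R * p ^+ l.+1.*2.
have B_le : 0 <= B <= t.+1%:R * D ^+ t.+1 / n%:R.
  apply/andP; split.
    apply: sumr_ge0 => l _; apply: mulr_ge0; last exact: exprn_ge0.
    by apply: mulr_ge0 => //; apply: exprn_ge0.
  rewrite ler_pdivlMr // mulr_suml.
  have -> : t.+1%:R * D ^+ t.+1 = \sum_(l < t.+1) D ^+ t.+1.
    by rewrite sumr_const card_ord mulr_natl.
  apply: ler_sum => l _.
  (* Fixing both endpoints costs one factor n against a power of n m p^2. As D is at least 1, every
     power is then bounded by the largest, D^(t+1). *)
  have -> : (m * n)%:R ^+ l * m%:R * p ^+ l.+1.*2 * n%:R =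
            (n%:R * m%:R * p ^+ 2) ^+ l.+1.
    by rewrite -mul2n exprM natrM !exprMn ![_ ^+ l.+1]exprS; ring.
  apply: (@le_trans _ _ (D ^+ l.+1)).
    by rewrite lerXn2r // nnegrE ?mulr_ge0 ?exprn_ge0 //; apply: le_trans D_ge1.
  by rewrite ler_weXn2l.
set D' := t.+1%:R * D ^+ t.+1 in B_le Dc.
have D'_ge0 : 0 <= D' by rewrite mulr_ge0 // exprn_ge0 //; apply: le_trans D_ge1.
have dense_le (k : nat) (W : {set 'I_n}) : #|W| == k ->
    prob p (dense k W) <= 'C(k * k, c * k)%:R * (D' / n%:R) ^+ (c * k).
  move=> /eqP Wk.
  apply: (@le_trans _ _ (\sum_(F : {set 'I_n * 'I_n} |
      (F \subset setX W W) && (#|F| == c * k)%N)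
      prob p (fun E : bipartite n m => linked t E set0 (enum F)))).
    exact: prob_union.
  apply: (@le_trans _ _ (\sum_(F : {set 'I_n * 'I_n} |
      (F \subset setX W W) && (#|F| == c * k)%N) (D' / n%:R) ^+ (c * k))).
    apply: ler_sum => F /andP[_ /eqP Fk].
    apply: le_trans (prob_linked p01 t set0 (enum_uniq _)) _.
    rewrite cards0 expr0 mul1r -cardE Fk lerXn2r ?nnegrE //; first by case/andP: B_le.
      by rewrite divr_ge0.
    by case/andP: B_le.
  rewrite sumr_const -[leLHS]mulr_natl -Wk -cardsX -cards_draws cardsE; exact: lexx.
apply: (@le_trans _ _ (\sum_(k < n.+1 | (0 < k)%N) k%:R * 2^-1 ^+ k / n%:R)).
  apply: (@le_trans _ _ (\sum_(k < n.+1 | (0 < k)%N)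
      \sum_(W : {set 'I_n} | #|W| == k) prob p (dense k W))).
    apply: (@le_trans _ _ (\sum_(k < n.+1 | (0 < k)%N)
      prob p (fun E => exists2 W : {set 'I_n}, #|W| == k & dense k W E))).
      exact: prob_union.
    by apply: ler_sum => k _; apply: prob_union.
  apply: ler_sum => k k_gt0.
  have kn : (0 < k <= n)%N by rewrite k_gt0 -ltnS ltn_ord.
  apply: le_trans (first_moment_term D'_ge0 c_gt2 Dc kn).
  rewrite -mulrA; apply: le_trans (ler_sum _ (fun W => @dense_le k W)) _.
  have -> : 'C(n, k) = #|[pred W : {set 'I_n} | #|W| == k]|.
    by rewrite -[n in 'C(n, _)]card_ord -card_draws cardsE.
  by rewrite sumr_const -[leLHS]mulr_natl.
rewrite -mulr_suml ler_pM2r ?invr_gt0 //.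
apply: le_trans (sum_half_pow _ n.+1); rewrite big_mkcond /=; apply: ler_sum => k _.
case: ifP => // _; apply: mulr_ge0 => //; apply: exprn_ge0.
by rewrite invr_ge0.
Qed.

(* The index t : nat encodes the half-integer r = t/2 >= 0 (paths of length <= 2r+1 = t+1);
   f t stands for f(r). *)
Theorem mainTheorem6 (alpha beta gamma : R) :
  Rlt R1 alpha -> Rlt R0 beta -> Rlt R0 gamma ->
  exists f : nat -> R, forall t : nat,
    Un_cv (fun n : nat =>
             prob (p_of gamma alpha n)
               (fun E : bipartite n (m_of beta alpha n) =>
                  tnabla_le (igraph E) t (f t)))
          R1.
Proof.
move=> alpha_gt1 beta_gt0 gamma_gt0.
have [a1 b0 g0] : [/\ 1 < alpha, 0 < beta & 0 < gamma] by split; apply/RltP.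
have a0 : 0 < (alpha - 1) / 2 by lra.
(* The exponent is K+1 because a large attribute has at least K+1 vertices. *)
have [K alphaK] : exists K, alpha + 1 <= (alpha - 1) / 2 * K.+1%:R.
  pose r := (alpha + 1) / ((alpha - 1) / 2).
  exists (Num.bound r); rewrite mulrC -ler_pdivrMr //.
  have a2 : 0 < alpha + 1 by lra.
  have r_ge0 : 0 <= r by rewrite ltW // divr_gt0.
  by rewrite ltW // (lt_trans (archi_boundP r_ge0)) // ltr_nat.
pose D := Num.max 1 (beta * gamma ^+ 2).
have D_ge1 : 1 <= D by rewrite le_max lexx.
(* The summand 3 gives c > 2; the other dominates 8 times the path constant. *)
pose c t := (3 + Num.bound (8 * (t.+1%:R * D ^+ t.+1)))%N.
exists (fun t => (c t * (t.+1 * K ^ 2))%:R) => t eps eps_gt0.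
(* C/n is the total failure probability: the first summand comes from large attributes, the 2 from
   linked families. *)
pose C := beta * gamma ^+ K.+1 + 2.
have C_gt0 : 0 < C.
  by apply: addr_gt0 => //; apply: mulr_gt0 => //; apply: exprn_gt0.
have {}eps_gt0 : 0 < eps by apply/RltP.
(* The first bound forces gamma at most n, hence p at most 1; the second forces C/n < eps. *)
exists (Num.bound gamma + Num.bound (C / eps)).+1 => n /ssrnat.leP Nn.
have n_gt0 : (0 < n)%N by apply: leq_trans Nn.
have nR : 0 < n%:R :> R by rewrite ltr0n.
have gamma_n : gamma <= n%:R.
  rewrite ltW // (lt_trans (archi_boundP (ltW g0))) // ltr_nat.
  by apply: leq_trans Nn; rewrite ltnS leq_addr.
have C_n : C / n%:R < eps.
  rewrite ltr_pdivrMr // mulrC -ltr_pdivrMr //.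
  rewrite (lt_trans (archi_boundP (ltW (divr_gt0 C_gt0 eps_gt0)))) // ltr_nat.
  by apply: leq_trans Nn; rewrite ltnS leq_addl.
set m := m_of beta alpha n; set p := p_of gamma alpha n.
have p01 : 0 <= p <= 1.
  apply/andP; split; first by apply/RleP/p_of_ge0.
  have /RleP := p_of_le alpha_gt1 gamma_gt0 n_gt0.
  by rewrite INRE RmultE RinvE => /le_trans; apply; rewrite ler_pdivrMr ?mul1r.
have mpD : n%:R * m%:R * p ^+ 2 <= D.
  have /RleP := n_m_p2_le alpha gamma beta_gt0 n_gt0.
  by rewrite !INRE !RpowE !RmultE => /le_trans; apply; rewrite le_max lexx orbT.
have large : m%:R * (n%:R * p) ^+ K.+1 <= beta * gamma ^+ K.+1 / n%:R.
  have aK : Rle (Rplus alpha 1) (Rmult (Rdiv (Rminus alpha 1) 2) (INR K.+1)).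
    by apply/RleP; rewrite INRE.
  have /RleP := m_np_pow_le beta_gt0 gamma_gt0 n_gt0 aK.
  by rewrite !INRE !RpowE !RmultE RinvE.
have Dc : 8 * (t.+1%:R * D ^+ t.+1) <= (c t)%:R.
  have D0 : 0 <= D by apply: le_trans D_ge1.
  rewrite ltW // (lt_le_trans (archi_boundP _)) ?ler_nat ?leq_addl //.
  by rewrite !mulr_ge0 // exprn_ge0.
have := @prob_dense_minor n m t K (c t) p D n_gt0 p01 D_ge1 mpD isT Dc.
rewrite RdistE /Rgt => bad; apply/RltP; apply: le_lt_trans C_n.
rewrite distrC ger0_norm ?subr_ge0 ?prob_le1 // probC opprB addrC subrK.
by apply: le_trans bad _; rewrite /C [leRHS]mulrDl; apply: lerD.
Qed.
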